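(* Let $D_{s4}(a,c)=a(a^3-2ac^2-2a-4c^2)$. There exist real parameters $(a,c)$ with $D_{s4}(a,c)\neq 0$ for which $T$ has a 4-cycle with symbolic sequence $3\to 3\to 4\to 4$, i.e. four distinct points $s_1,s_2\in Q_3$, $s_3,s_4\in Q_4$ with $s_2=T_3(s_1)$, $s_3=T_3(s_2)$, $s_4=T_4(s_3)$, $s_1=T_4(s_4)$. Whenever $D_{s4}(a,c)\neq 0$ and such a cycle exists, its points are $s_i=\left(\frac{N_{xsi}}{D_{s4}},\frac{N_{ysi}}{D_{s4}}\right)$, $i=1,2,3,4$, with \begin{align*} N_{xs1}&=(a+c+1)(a^3+2a^2c+2a^2+2ac^2+4ac-2a+2c^3-2c^2+2c-2),\\ N_{ys1}&=3a^3+6a^2c+4a^2+4ac^2+10ac-2a+2c^3+2c^2+2c-2,\\ N_{xs2}&=(a+c+1)(a^3+2a^2c-2c^3+2c^2-2c+2),\\ N_{ys2}&=3a^3+4a^2c+2a^2-2ac^2+6ac-4a-2c^3-2c^2+2c-2,\\ N_{xs3}&=(a+c+1)(a^3-2ac^2+4ac-2a+2c^3-2c^2+2c-2),\\ N_{ys3}&=a^3+2a^2+2ac+2a+2c^3-2c^2+2c+2,\\ N_{xs4}&=(a+c+1)(a^3+2a^2+4ac+2c^3-2c^2+2c-2),\\ N_{ys4}&=a^3+2a^2c+2ac^2+2ac-4a+2c^3-2c^2-2c-2. \end{align*}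
   Context: For real parameters $a,c$, $T:\mathbb{R}^2\to\mathbb{R}^2$ is $T(x,y)=(|x|+ay-1,\;x+c|y|-1)$. The closed quadrants are $Q_1=\{x\ge 0,y\ge 0\}$, $Q_2=\{x\le 0,y\ge 0\}$, $Q_3=\{x\le 0,y\le 0\}$, $Q_4=\{x\ge 0,y\le 0\}$. On $Q_3$ the map $T$ coincides with $T_3(x,y)=(-x+ay-1,x-cy-1)$ and on $Q_4$ with $T_4(x,y)=(x+ay-1,x-cy-1)$. *)

(* Defs.v *)
From Stdlib Require Import Reals Lra List.
Import ListNotations.
Local Open Scope R_scope.

Definition T (a c : R) (p : R * R) : R * R :=
  (Rabs (fst p) + a * snd p - 1, fst p + c * Rabs (snd p) - 1).

Definition Q3 (p : R * R) : Prop := fst p <= 0 /\ snd p <= 0.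
Definition Q4 (p : R * R) : Prop := 0 <= fst p /\ snd p <= 0.

Definition T3 (a c : R) (p : R * R) : R * R :=
  (- fst p + a * snd p - 1, fst p - c * snd p - 1).
Definition T4 (a c : R) (p : R * R) : R * R :=
  (fst p + a * snd p - 1, fst p - c * snd p - 1).

Lemma T_Q3 (a c : R) (p : R * R) : Q3 p -> T a c p = T3 a c p.
Proof.
intros [Hx Hy]; unfold T, T3.
rewrite (Rabs_left1 _ Hx), (Rabs_left1 _ Hy); f_equal; ring.
Qed.

Lemma T_Q4 (a c : R) (p : R * R) : Q4 p -> T a c p = T4 a c p.
Proof.
intros [Hx Hy]; unfold T, T4.
rewrite (Rabs_pos_eq _ Hx), (Rabs_left1 _ Hy); f_equal; ring.
Qed.

Definition cycle_3344 (a c : R) (s1 s2 s3 s4 : R * R) : Prop :=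
  NoDup [s1; s2; s3; s4] /\
  Q3 s1 /\ Q3 s2 /\ Q4 s3 /\ Q4 s4 /\
  s2 = T3 a c s1 /\ s3 = T3 a c s2 /\ s4 = T4 a c s3 /\ s1 = T4 a c s4.

(* Such a cycle is a genuine 4-cycle of [T] visiting Q3, Q3, Q4, Q4. *)
Lemma cycle_3344_T (a c : R) (s1 s2 s3 s4 : R * R) :
  cycle_3344 a c s1 s2 s3 s4 <->
  NoDup [s1; s2; s3; s4] /\
  Q3 s1 /\ Q3 s2 /\ Q4 s3 /\ Q4 s4 /\
  s2 = T a c s1 /\ s3 = T a c s2 /\ s4 = T a c s3 /\ s1 = T a c s4.
Proof.
unfold cycle_3344.
split; intros (Hd & H1 & H2 & H3 & H4 & H);
  [ rewrite !T_Q3, !T_Q4 by assumption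
  | rewrite !T_Q3, !T_Q4 in H by assumption ];
  tauto.
Qed.

Definition Ds4 (a c : R) : R := a * (a^3 - 2*a*c^2 - 2*a - 4*c^2).

Definition Nxs1 (a c : R) : R :=
  (a + c + 1) * (a^3 + 2*a^2*c + 2*a^2 + 2*a*c^2 + 4*a*c - 2*a
                 + 2*c^3 - 2*c^2 + 2*c - 2).
Definition Nys1 (a c : R) : R :=
  3*a^3 + 6*a^2*c + 4*a^2 + 4*a*c^2 + 10*a*c - 2*a
  + 2*c^3 + 2*c^2 + 2*c - 2.

Definition Nxs2 (a c : R) : R :=
  (a + c + 1) * (a^3 + 2*a^2*c - 2*c^3 + 2*c^2 - 2*c + 2).
Definition Nys2 (a c : R) : R :=
  3*a^3 + 4*a^2*c + 2*a^2 - 2*a*c^2 + 6*a*c - 4*a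
  - 2*c^3 - 2*c^2 + 2*c - 2.

Definition Nxs3 (a c : R) : R :=
  (a + c + 1) * (a^3 - 2*a*c^2 + 4*a*c - 2*a + 2*c^3 - 2*c^2 + 2*c - 2).
Definition Nys3 (a c : R) : R :=
  a^3 + 2*a^2 + 2*a*c + 2*a + 2*c^3 - 2*c^2 + 2*c + 2.

Definition Nxs4 (a c : R) : R :=
  (a + c + 1) * (a^3 + 2*a^2 + 4*a*c + 2*c^3 - 2*c^2 + 2*c - 2).
Definition Nys4 (a c : R) : R :=
  a^3 + 2*a^2*c + 2*a*c^2 + 2*a*c - 4*a + 2*c^3 - 2*c^2 - 2*c - 2.

(* Main.v *)
Require Import Defs.
From Stdlib Require Import Reals.
From Stdlib Require Import Lra List.
Local Open Scope R_scope.

(** On a cycle with symbolic sequence 3344 the map acts by its affine branches,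
    so the first point is a fixed point of the affine return map
    [T4 o T4 o T3 o T3].  If [M] is the linear part of that map, its fixed
    points solve a two by two linear system whose determinant, [det (M - 1)],
    is exactly [Ds4 a c] ([return_det]).  When it is nonzero, Cramer's rule
    ([cramer]) gives the first point ([return_fixed_point]), and the three other
    points follow by pushing the formula through the branches.

    Existence is witnessed at [a = -1], [c = 1/4], where [Ds4 a c = -7/8].  Evaluating
    the closed formulas there gives four points with nonzero coordinates, each
    in the interior of the required quadrant. *)

(** Cramer's rule, without denominators. *)
Lemma cramer (m11 m12 m21 m22 b1 b2 x y : R) :
  m11 * x + m12 * y = b1 ->
  m21 * x + m22 * y = b2 ->
  (m11 * m22 - m12 * m21) * x = b1 * m22 - m12 * b2 /\
  (m11 * m22 - m12 * m21) * y = m11 * b2 - b1 * m21.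
Proof. intros <- <-; split; ring. Qed.

(** Entries of [M - 1], where [M] is the product of the squares of
    [[1, a], [1, -c]] and [[-1, a], [1, -c]], the linear parts of [T4] and
    [T3]. *)
Definition ret11 (a c : R) : R :=
  (1 + a) * (1 + a) - (a - a*c) * (1 + c) - 1.
Definition ret12 (a c : R) : R :=
  - (1 + a) * (a + a*c) + (a - a*c) * (a + c^2).
Definition ret21 (a c : R) : R :=
  (1 - c) * (1 + a) - (a + c^2) * (1 + c).
Definition ret22 (a c : R) : R :=
  - (1 - c) * (a + a*c) + (a + c^2) * (a + c^2) - 1.

Lemma return_det (a c : R) :
  ret11 a c * ret22 a c - ret12 a c * ret21 a c = Ds4 a c.
Proof. unfold ret11, ret12, ret21, ret22, Ds4; ring. Qed.

Definition return_map (a c : R) (p : R * R) : R * R :=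
  T4 a c (T4 a c (T3 a c (T3 a c p))).

Lemma return_map_affine (a c x y : R) :
  return_map a c (x, y) =
  (x + (ret11 a c * x + ret12 a c * y) + fst (return_map a c (0, 0)),
   y + (ret21 a c * x + ret22 a c * y) + snd (return_map a c (0, 0))).
Proof.
unfold return_map, T3, T4, ret11, ret12, ret21, ret22; cbn [fst snd].
f_equal; ring.
Qed.

Lemma return_fixed_point (a c : R) (s : R * R) :
  Ds4 a c <> 0 ->
  s = return_map a c s ->
  s = (Nxs1 a c / Ds4 a c, Nys1 a c / Ds4 a c).
Proof.
destruct s as [x y]; intros HD Hfix.
rewrite return_map_affine in Hfix; apply pair_equal_spec in Hfix as [Hx Hy].
destruct (cramer (ret11 a c) (ret12 a c) (ret21 a c) (ret22 a c)
            (- fst (return_map a c (0, 0))) (- snd (return_map a c (0, 0))) x y)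
  as [Ex Ey]; [lra | lra |].
rewrite return_det in Ex, Ey.
f_equal; apply (Rmult_eq_reg_l (Ds4 a c)); trivial.
- rewrite Ex; field_simplify_eq; trivial.
  unfold return_map, T3, T4, ret12, ret22, Nxs1; cbn [fst snd]; ring.
- rewrite Ey; field_simplify_eq; trivial.
  unfold return_map, T3, T4, ret11, ret21, Nys1; cbn [fst snd]; ring.
Qed.

(** The next three lemmas hold because, after clearing the denominator
    [Ds4 a c], each is a polynomial identity in [a] and [c]. *)
Lemma T3_s1 (a c : R) :
  Ds4 a c <> 0 ->
  T3 a c (Nxs1 a c / Ds4 a c, Nys1 a c / Ds4 a c) =
  (Nxs2 a c / Ds4 a c, Nys2 a c / Ds4 a c).
Proof.
intros HD; unfold T3; cbn [fst snd].
f_equal; field_simplify_eq; trivial; unfold Nxs1, Nys1, Nxs2, Nys2, Ds4; ring.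
Qed.

Lemma T3_s2 (a c : R) :
  Ds4 a c <> 0 ->
  T3 a c (Nxs2 a c / Ds4 a c, Nys2 a c / Ds4 a c) =
  (Nxs3 a c / Ds4 a c, Nys3 a c / Ds4 a c).
Proof.
intros HD; unfold T3; cbn [fst snd].
f_equal; field_simplify_eq; trivial; unfold Nxs2, Nys2, Nxs3, Nys3, Ds4; ring.
Qed.

Lemma T4_s3 (a c : R) :
  Ds4 a c <> 0 ->
  T4 a c (Nxs3 a c / Ds4 a c, Nys3 a c / Ds4 a c) =
  (Nxs4 a c / Ds4 a c, Nys4 a c / Ds4 a c).
Proof.
intros HD; unfold T4; cbn [fst snd].
f_equal; field_simplify_eq; trivial; unfold Nxs3, Nys3, Nxs4, Nys4, Ds4; ring.
Qed.

Lemma cycle_example :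
  cycle_3344 (-1) (1/4)
    (-25/112, -52/112) (-35/112, -124/112) (47/112, -116/112) (51/112, -36/112).
Proof.
unfold cycle_3344, Q3, Q4, T3, T4; cbn [fst snd].
split; [| repeat split; try lra; f_equal; lra].
(* The four abscissas are already distinct. *)
apply (NoDup_map_inv fst); cbn [map fst].
repeat constructor; cbn [In]; lra.
Qed.

Theorem proposition3p19 :
  (exists a c : R,
     Ds4 a c <> 0 /\
     exists s1 s2 s3 s4 : R * R, cycle_3344 a c s1 s2 s3 s4) /\
  (forall (a c : R) (s1 s2 s3 s4 : R * R),
     Ds4 a c <> 0 ->
     cycle_3344 a c s1 s2 s3 s4 ->
     s1 = (Nxs1 a c / Ds4 a c, Nys1 a c / Ds4 a c) /\
     s2 = (Nxs2 a c / Ds4 a c, Nys2 a c / Ds4 a c) /\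
     s3 = (Nxs3 a c / Ds4 a c, Nys3 a c / Ds4 a c) /\
     s4 = (Nxs4 a c / Ds4 a c, Nys4 a c / Ds4 a c)).
Proof.
split.
- exists (-1), (1/4); split.
  + unfold Ds4; lra.
  + do 4 eexists; exact cycle_example.
- intros a c s1 s2 s3 s4 HD (_ & _ & _ & _ & _ & E2 & E3 & E4 & E1).
  assert (H1 : s1 = (Nxs1 a c / Ds4 a c, Nys1 a c / Ds4 a c)).
  { apply return_fixed_point; trivial.
    unfold return_map; rewrite <- E2, <- E3, <- E4; exact E1. }
  rewrite H1, (T3_s1 a c HD) in E2.
  rewrite E2, (T3_s2 a c HD) in E3.
  rewrite E3, (T4_s3 a c HD) in E4.
  auto.
Qed.
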